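(* Let $\mathcal X\subset\mathbb R^n$ be a nonempty closed convex set, let $F$ be an $\mathcal X$-compatible mirror map and let $\xi:=(\xi_t)_{t\ge 1}$ be a sequence in $\mathbb R^n$. Let $(x_t)_{t\ge1}$ be a sequence of MD$(\mathcal X,F,\xi)$ iterates. Then $(x_t,\nabla F(x_t))_{t\ge1}$ is a sequence of UMD$(F+I_{\mathcal X},\xi)$ iterates.
   Context: $\langle\cdot,\cdot\rangle$ is the canonical scalar product on $\mathbb R^n$. $I_{\mathcal X}$ is $0$ on $\mathcal X$ and $+\infty$ elsewhere. For convex $g:\mathbb R^n\to\mathbb R\cup\{+\infty\}$, $\operatorname{dom}g=\{x:g(x)<\infty\}$, $g^*(\vartheta)=\sup_{x\in\mathbb R^n}\{\langle\vartheta,x\rangle-g(x)\}$, and, if $g$ is differentiable at $x$, $D_g(x',x)=g(x')-g(x)-\langle\nabla g(x),x'-x\rangle$. $\mathcal X$-compatible mirror map: a function $F:\mathbb R^n\to\mathbb R\cup\{+\infty\}$ such that, with $\mathcal D_F:=\operatorname{int}\operatorname{dom}F$: (i) $F$ is lower-semicontinuous and strictly convex; (ii) $F$ is differentiable on $\mathcal D_F$; (iii) $\nabla F(\mathcal D_F)=\mathbb R^n$; (iv) $\mathcal X\subset\operatorname{cl}\mathcal D_F$; (v) $\mathcal X\cap\mathcal D_F\ne\emptyset$. For such $F$, $F^*$ is finite and differentiable on $\mathbb R^n$ with $\nabla F^*(\mathbb R^n)=\mathcal D_F$, and for every $x_0\in\mathcal D_F$ the minimizer of $D_F(\cdot,x_0)$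 over $\mathcal X$ exists, is unique and lies in $\mathcal X\cap\mathcal D_F$. MD$(\mathcal X,F,\xi)$ iterates (mirror descent): $x_1\in\mathcal X\cap\mathcal D_F$ and $x_{t+1}=\operatorname{arg\,min}_{x\in\mathcal X}D_F\big(x,\nabla F^*(\nabla F(x_t)+\xi_t)\big)$ for $t\ge1$. An $\mathcal X$-regularizer is a function $h:\mathbb R^n\to\mathbb R\cup\{+\infty\}$ that is strictly convex, lower-semicontinuous, with $\operatorname{cl}\operatorname{dom}h=\mathcal X$ and $\operatorname{dom}h^*=\mathbb R^n$; then $h^*$ is differentiable on $\mathbb R^n$. If $F$ is an $\mathcal X$-compatible mirror map, $F+I_{\mathcal X}$ is an $\mathcal X$-regularizer. UMD$(h,\xi)$ iterates (unified mirror descent), for an $\mathcal X$-regularizer $h$: a sequence $(x_t,\vartheta_t)_{t\ge1}$ in $\mathbb R^n\times\mathbb R^n$ such that for all $t\ge1$: $x_t=\nabla h^*(\vartheta_t)$, and $\langle\vartheta_{t+1}-\vartheta_t-\xi_t,\,x-x_{t+1}\rangle\ge0$ for all $x\in\mathcal X$. *)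

(* Defs.v *)
From HB Require Import structures.
From mathcomp Require Import all_boot all_order all_algebra.
From mathcomp Require Import all_classical all_reals all_analysis.
Set Implicit Arguments.
Unset Strict Implicit.
Unset Printing Implicit Defensive.
Import Order.TTheory GRing.Theory Num.Theory.
Import numFieldNormedType.Exports.
Local Open Scope classical_set_scope.
Local Open Scope ring_scope.

(* Vectors of R^n are row vectors; the topology of 'rV[R]_n comes from the
   sup norm, which induces the usual topology and notion of differentiability. *)

Definition dotv (R : realType) (n : nat) (u v : 'rV[R]_n) : R :=
  \sum_(i < n) u ord0 i * v ord0 i.

Definition edom (R : realType) (n : nat) (g : 'rV[R]_n -> \bar R) :
  set 'rV[R]_n := [set x | (g x < +oo)%E].

Definition indicator_fun (R : realType) (n : nat) (X : set 'rV[R]_n)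
  (x : 'rV[R]_n) : \bar R := if x \in X then 0%E else +oo%E.

Definition conjugate (R : realType) (n : nat) (g : 'rV[R]_n -> \bar R)
    (theta : 'rV[R]_n) : \bar R :=
  ereal_sup [set ((dotv theta x)%:E - g x)%E | x in [set: 'rV[R]_n]].

(* The finiteness condition prevents [fine], which sends infinite values to 0,
   from making an extended real-valued function spuriously differentiable. *)
Definition edifferentiable (R : realType) (n : nat) (g : 'rV[R]_n -> \bar R)
    (x : 'rV[R]_n) : Prop :=
  (\forall y \near x, g y \is a fin_num) /\
  differentiable (fine \o g : 'rV[R]_n -> R^o) x.

(* Meaningful only at points where [g] is [edifferentiable]. *)
Definition grad (R : realType) (n : nat) (g : 'rV[R]_n -> \bar R)
    (x : 'rV[R]_n) : 'rV[R]_n :=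
  \row_(i < n) 'D_(delta_mx ord0 i) (fine \o g : 'rV[R]_n -> R^o) x.

Definition bregman (R : realType) (n : nat) (g : 'rV[R]_n -> \bar R)
    (x' x : 'rV[R]_n) : \bar R :=
  (g x' - g x - (dotv (grad g x) (x' - x))%:E)%E.

Definition strictly_convex (R : realType) (n : nat)
    (g : 'rV[R]_n -> \bar R) : Prop :=
  forall (x y : 'rV[R]_n) (t : R),
    edom g x -> edom g y -> x <> y -> 0 < t -> t < 1 ->
    (g (t *: x + (1 - t) *: y)%R < t%:E * g x + (1 - t)%:E * g y)%E.

(* [*_gtNy] says that the codomain is R ∪ {+oo}. *)
Record mirror_map (R : realType) (n : nat) (X : set 'rV[R]_n)
    (F : 'rV[R]_n -> \bar R) : Prop := {
  mirror_map_gtNy : forall x, (-oo < F x)%E ;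
  mirror_map_lsc : lower_semicontinuous F ;
  mirror_map_strictly_convex : strictly_convex F ;
  mirror_map_differentiable : forall x, (edom F)° x -> edifferentiable F x ;
  mirror_map_grad_surj : grad F @` (edom F)° = [set: 'rV[R]_n] ;
  mirror_map_sub_closure : X `<=` closure (edom F)° ;
  mirror_map_meet : X `&` (edom F)° !=set0 }.

Record regularizer (R : realType) (n : nat) (X : set 'rV[R]_n)
    (h : 'rV[R]_n -> \bar R) : Prop := {
  regularizer_gtNy : forall x, (-oo < h x)%E ;
  regularizer_strictly_convex : strictly_convex h ;
  regularizer_lsc : lower_semicontinuous h ;
  regularizer_closure_dom : closure (edom h) = X ;
  regularizer_dom_conjugate : edom (conjugate h) = [set: 'rV[R]_n] }.

Definition is_argmin (T : Type) (R : realType) (X : set T) (f : T -> \bar R)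
    (z : T) : Prop :=
  X z /\ forall x, X x -> (f z <= f x)%E.

(* Sequences are indexed by t >= 1; their values at 0 are irrelevant. *)

Record MD_iterates (R : realType) (n : nat) (X : set 'rV[R]_n)
    (F : 'rV[R]_n -> \bar R) (xi x : nat -> 'rV[R]_n) : Prop := {
  MD_init : (X `&` (edom F)°) (x 1%N) ;
  MD_step : forall t, (1 <= t)%N ->
    is_argmin X
      (fun z => bregman F z (grad (conjugate F) (grad F (x t) + xi t)))
      (x t.+1) }.

Record UMD_iterates (R : realType) (n : nat) (X : set 'rV[R]_n)
    (h : 'rV[R]_n -> \bar R) (xi : nat -> 'rV[R]_n)
    (xtheta : nat -> 'rV[R]_n * 'rV[R]_n) : Prop := {
  UMD_regularizer : regularizer X h ;
  UMD_differentiable : forall t, (1 <= t)%N ->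
    edifferentiable (conjugate h) (xtheta t).2 ;
  UMD_mirror : forall t, (1 <= t)%N ->
    (xtheta t).1 = grad (conjugate h) (xtheta t).2 ;
  UMD_variational : forall t, (1 <= t)%N -> forall x, X x ->
    0 <= dotv ((xtheta t.+1).2 - (xtheta t).2 - xi t) (x - (xtheta t.+1).1) }.

(* Main.v *)
(* With h = F + I_X, a subgradient u of h at x makes h^* differentiable at u with
   gradient x: strict convexity and lower semicontinuity give a gap
   h(y) - h(x) - <u, y - x> >= c > 0 on the sphere |y - x| = e, convexity turns it
   into linear growth outside the ball, so perturbing u by a small d moves the
   supremum by <d, x> + O(e |d|).  Applied to F, this gives
   grad F^* (grad F y) = y, so a mirror descent step returns a point z of X where
   some theta = grad F(x_t) + xi_t is a subgradient of h.  Such a z is in the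
   interior of dom F: otherwise the gradients of F along a segment from z to an
   interior point of X stay bounded, and a limit point of them is a subgradient of
   F at z; since grad F is onto, it is also the gradient at an interior point y,
   whence z = y by strict convexity.  The variational inequality is then the first
   order condition at z. *)
From HB Require Import structures.
Require Import Defs.
From mathcomp Require Import all_boot all_order all_algebra.
From mathcomp Require Import all_classical all_reals all_analysis.
From mathcomp Require Import ring lra.
Import Order.TTheory GRing.Theory Num.Theory.
Import numFieldNormedType.Exports.
Local Open Scope classical_set_scope.
Local Open Scope ring_scope.

Set Implicit Arguments.
Unset Strict Implicit.
Unset Printing Implicit Defensive.

(** * Scalar product: bilinearity, bounds in the sup norm, continuity *)

Section ScalarProduct.
Context {R : realType} {n : nat}.
Implicit Types (u v w : 'rV[R]_n) (a : R).

Lemma dotvC u v : dotv u v = dotv v u.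
Proof. by apply: eq_bigr => i _; rewrite mulrC. Qed.

Lemma dotvDr u v w : dotv u (v + w) = dotv u v + dotv u w.
Proof. by rewrite -big_split; apply: eq_bigr => i _; rewrite mxE mulrDr. Qed.

Lemma dotvZr u a v : dotv u (a *: v) = a * dotv u v.
Proof. by rewrite mulr_sumr; apply: eq_bigr => i _; rewrite mxE mulrCA. Qed.

Lemma dotvBr u v w : dotv u (v - w) = dotv u v - dotv u w.
Proof. by rewrite -scaleN1r dotvDr dotvZr mulN1r. Qed.

Lemma dotvDl u v w : dotv (u + v) w = dotv u w + dotv v w.
Proof. by rewrite ![dotv _ w]dotvC dotvDr. Qed.

Lemma dotvBl u v w : dotv (u - v) w = dotv u w - dotv v w.
Proof. by rewrite ![dotv _ w]dotvC dotvBr. Qed.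

Lemma dotv_delta u i : dotv u (delta_mx ord0 i) = u ord0 i.
Proof.
rewrite /dotv (bigD1 i)//= mxE !eqxx mulr1 big1 ?addr0// => j /negPf ji.
by rewrite mxE ji mulr0.
Qed.

Lemma ler_coord_norm u i : `|u ord0 i| <= `|u|.
Proof.
rewrite [leRHS]/Num.norm /= mx_normrE.
by apply: (le_bigmax _ (fun ij => `|u ij.1 ij.2|) (ord0, i)).
Qed.

(** The norm is the sup norm, so each of the [n] terms is bounded separately; this is where the
    factor [n] comes from. *)
Lemma ler_norm_dotv u v : `|dotv u v| <= n%:R * `|u| * `|v|.
Proof.
rewrite (le_trans (ler_norm_sum _ _ _))// -mulrA mulr_natl.
rewrite -[X in _ *+ X]card_ord -sumr_const.
by apply: ler_sum => i _; rewrite normrM ler_pM// ler_coord_norm.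
Qed.

Lemma dotv_is_linear u : linear (dotv u : 'rV[R]_n -> R^o).
Proof. by move=> a v w; rewrite dotvDr dotvZr. Qed.

HB.instance Definition _ u := GRing.isLinear.Build R 'rV[R]_n R^o *:%R
  (dotv u : 'rV[R]_n -> R^o) (dotv_is_linear u).

Lemma continuous_dotv u : continuous (dotv u : 'rV[R]_n -> R^o).
Proof.
apply/linear_bounded_continuous/linear_boundedP.
near=> r => v; rewrite (le_trans (ler_norm_dotv u v))//.
by rewrite ler_wpM2r//; near: r; apply: nbhs_pinfty_ge; rewrite num_real.
Unshelve. all: by end_near. Qed.

Lemma near_dotv u x a : 0 < a -> \forall y \near x, `|dotv u x - dotv u y| < a.
Proof.
move=> a0; have := @continuous_dotv u x.
by move/(@cvgrPdist_lt _ _ _ _ (nbhs_filter x)); exact.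
Qed.

End ScalarProduct.

(** * Gradients and directional derivatives *)

Section Gradient.
Context {R : realType} {n : nat}.
Implicit Types (f : 'rV[R]_n -> R^o) (g : 'rV[R]_n -> \bar R) (x v : 'rV[R]_n).

(** The hypothesis is a first order expansion with little-o remainder; uniqueness of the
    differential then identifies it with [dotv u]. *)
Lemma differentiable_dotv f x u :
  (forall e : R, 0 < e ->
    \forall d \near (0 : 'rV[R]_n), `|f (d + x) - f x - dotv u d| <= e * `|d|) ->
  differentiable f x /\ forall v, 'D_v f x = dotv u v.
Proof.
move=> fx.
have fE : f \o shift x = cst (f x) + (dotv u : 'rV[R]_n -> R^o) +o_ (0 : 'rV[R]_n) id.
  apply/eqaddoP => e e0; near=> d.
  rewrite !fctE opprD addrA; near: d; exact: fx.
have cu := @continuous_dotv _ _ u.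
have du := @diff_unique _ _ _ f (dotv u : 'rV[R]_n -> R^o) x cu fE.
have df : differentiable f x by apply/diff_locallyP; rewrite du; split.
by split => // v; rewrite deriveE// du.
Unshelve. all: by end_near. Qed.

Lemma derive_grad g x v : edifferentiable g x ->
  'D_v (fine \o g : 'rV[R]_n -> R^o) x = dotv (grad g x) v.
Proof.
move=> [_ dg]; rewrite deriveE// {1}(row_sum_delta v) linear_sum.
by apply: eq_bigr => i _; rewrite linearZ/= mxE deriveE// mulrC.
Qed.

(** The two-sided limit is also the limit from the right. Convexity and membership in [X] control
    only the steps [h > 0] along a segment. *)
Lemma derive_le_right f x v (c : R) : differentiable f x ->
  (\forall h \near (0 : R)^'+, f (h *: v + x) - f x <= h * c) -> 'D_v f x <= c.
Proof.
move=> /(@diff_derivable _ _ _ f x v) df fc.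
apply: (cvgr_to_le (cvg_dnbhs_at_right df)).
near=> h.
have h0 : 0 < h by near: h; exact: nbhs_right_gt.
by rewrite /= -ler_pdivlMl ?invr_gt0// invrK; near: h.
Unshelve. all: by end_near. Qed.

Lemma derive_ge_right f x v (c : R) : differentiable f x ->
  (\forall h \near (0 : R)^'+, h * c <= f (h *: v + x) - f x) -> c <= 'D_v f x.
Proof.
move=> /(@diff_derivable _ _ _ f x v) df fc.
apply: (cvgr_to_ge (cvg_dnbhs_at_right df)).
near=> h.
have h0 : 0 < h by near: h; exact: nbhs_right_gt.
by rewrite /= -ler_pdivrMl ?invr_gt0// invrK; near: h.
Unshelve. all: by end_near. Qed.

End Gradient.

(** * Subgradients of strictly convex functions *)

Definition subgradient (R : realType) (n : nat) (g : 'rV[R]_n -> \bar R)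
    (x : 'rV[R]_n) : set 'rV[R]_n :=
  [set u | forall y, (g x + (dotv u (y - x))%:E <= g y)%E].

Section StrictlyConvex.
Context {R : realType} {n : nat} {g : 'rV[R]_n -> \bar R}.
Hypotheses (gNy : forall x, (-oo < g x)%E) (gcvx : strictly_convex g).
Implicit Types (x y u v z : 'rV[R]_n) (t : R).

Lemma edomE x : edom g x -> g x = (fine (g x))%:E.
Proof. by move=> gx; rewrite fineK// fin_numE -ltey -ltNye gx gNy. Qed.

Lemma strictly_convex_lt x y t : edom g x -> edom g y -> x <> y ->
  0 < t -> t < 1 ->
  (g (x + t *: (y - x)) < (fine (g x) + t * (fine (g y) - fine (g x)))%:E)%E.
Proof.
move=> gx gy xy t0 t1.
have -> : x + t *: (y - x) = t *: y + (1 - t) *: x.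
  by rewrite scalerBr scalerBl scale1r addrCA addrA.
have := gcvx gy gx (not_eq_sym xy) t0 t1.
rewrite [in X in (_ < X)%E -> _](edomE gx) [in X in (_ < X)%E -> _](edomE gy).
move=> /lt_le_trans; apply; rewrite -!EFinM -EFinD lee_fin; lra.
Qed.

Lemma strictly_convex_le x y t : edom g x -> edom g y -> 0 <= t -> t <= 1 ->
  (g (x + t *: (y - x)) <= (fine (g x) + t * (fine (g y) - fine (g x)))%:E)%E.
Proof.
move=> gx gy; rewrite le_eqVlt => /predU1P[<- _|t0].
  by rewrite scale0r mul0r !addr0 -edomE.
rewrite le_eqVlt => /predU1P[->|t1].
  by rewrite scale1r mul1r !subrKC -edomE.
have [->|/eqP xy] := eqVneq x y.
  by rewrite !subrr scaler0 mulr0 !addr0 -edomE.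
exact/ltW/strictly_convex_lt.
Qed.

Lemma edom_segment x y t : edom g x -> edom g y -> 0 <= t -> t <= 1 ->
  edom g (x + t *: (y - x)).
Proof.
move=> gx gy t0 t1.
exact: le_lt_trans (strictly_convex_le gx gy t0 t1) (ltry _).
Qed.

(** Since [x] is only in the closure, a nearby point [x'] of the domain replaces it as centre of the
    homothety of ratio [t]. *)
Lemma interior_segment x y t : closure (edom g) x -> (edom g)° y ->
  0 < t -> t <= 1 -> (edom g)° (x + t *: (y - x)).
Proof.
move=> gx /nbhs_normP[r /= r0 gr] t0 t1.
(* Moving [x] to [x'] and the target point to [m] costs at most [t * r / 2] each; after division by
   [t] the total stays below [r]. *)
have tr0 : 0 < t * r / 2 by rewrite divr_gt0// mulr_gt0.
have [x' [gx' xx']] : exists x', edom g x' /\ `|x - x'| < t * r / 2.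
  have /gx[x' [gx' xx']] : nbhs x (ball x (t * r / 2)) by exact: nbhsx_ballx.
  by exists x'; split => //; move: xx'; rewrite -ball_normE.
apply/(nbhs_normP _ (edom g)); exists (t * r / 2) => //= m /= mx.
(* [m] is the point of parameter [t] between [x'] and a point close to [y] *)
pose y' := x' + t^-1 *: (m - x').
have -> : m = x' + t *: (y' - x').
  by rewrite /y' [_ + t^-1 *: _]addrC addrK scalerA divff ?gt_eqF// scale1r subrKC.
apply: edom_segment => //; last exact: ltW.
apply: gr => /=.
have -> : y - y' = t^-1 *: ((x + t *: (y - x) - m) - (1 - t) *: (x - x')).
  by apply/rowP => i; rewrite !mxE; field; rewrite gt_eqF.
rewrite normrZ ger0_norm ?invr_ge0 1?ltW// ltr_pdivrMl//.
rewrite (le_lt_trans (ler_normB _ _))//.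
have : `|(1 - t) *: (x - x')| <= `|x - x'|.
  by rewrite normrZ ler_piMl// ger0_norm ?subr_ge0// lerBlDr lerDl ltW.
lra.
Qed.

Lemma subgradient_fine x u y : subgradient g x u -> edom g x -> edom g y ->
  fine (g x) + dotv u (y - x) <= fine (g y).
Proof.
move=> xu gx gy; have := xu y.
by rewrite (edomE gx) (edomE gy) -EFinD lee_fin.
Qed.

(** The subgradient inequality at the midpoint of [x] and [y] meets strict convexity there. *)
Lemma subgradient_lt x u y : subgradient g x u -> edom g x -> y <> x ->
  (g x + (dotv u (y - x))%:E < g y)%E.
Proof.
move=> xu gx yx.
have [gy|] := boolP (g y < +oo)%E; last first.
  by rewrite -leNgt leye_eq => /eqP ->; rewrite (edomE gx) -EFinD ltry.
have h0 : 0 < 2^-1 :> R by rewrite invr_gt0.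
have h1 : 2^-1 < 1 :> R by lra.
have := le_lt_trans (xu _) (strictly_convex_lt gx gy (not_eq_sym yx) h0 h1).
rewrite [x + _]addrC addrK dotvZr (edomE gx) (edomE gy) -!EFinD !lte_fin /=.
lra.
Qed.

Lemma subgradient_inj x y u : edom g x -> edom g y ->
  subgradient g x u -> subgradient g y u -> x = y.
Proof.
move=> gx gy xu yu; apply: contrapT => xy.
have := subgradient_lt xu gx (not_eq_sym xy).
rewrite (edomE gx) (edomE gy) -EFinD lte_fin.
have := subgradient_fine yu gy gx.
rewrite !dotvBr; lra.
Qed.

Lemma edifferentiable_edom x : edifferentiable g x -> edom g x.
Proof.
move=> [/nbhs_singleton gx _]; rewrite /edom/= ltey_eq gx //.
Qed.

(** By convexity, the difference quotients from [x] towards [y] are at most [g y - g x], hence so is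
    their limit. *)
Lemma grad_subgradient x : edifferentiable g x -> subgradient g x (grad g x).
Proof.
move=> dg y; have gx := edifferentiable_edom dg.
have [gy|] := boolP (g y < +oo)%E; last by rewrite -leNgt leye_eq => /eqP ->; rewrite leey.
rewrite (edomE gx) (edomE gy) -EFinD lee_fin -lerBrDl -derive_grad//.
apply: derive_le_right; first by case: dg.
near=> h.
have h0 : 0 <= h by apply/ltW; near: h; exact: nbhs_right_gt.
have h1 : h <= 1 by near: h; apply: nbhs_right_ltW.
rewrite /= lerBlDl [h *: _ + _]addrC -lee_fin -edomE; last exact: edom_segment.
exact: strictly_convex_le.
Unshelve. all: by end_near. Qed.

End StrictlyConvex.

(** * Differentiability of the conjugate at a subgradient *)

Section ConjugateDifferentiability.
Context {R : realType} {n : nat} {g : 'rV[R]_n -> \bar R}.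
Hypotheses (gNy : forall x, (-oo < g x)%E) (gcvx : strictly_convex g).
Hypothesis glsc : lower_semicontinuous g.
Variables (x0 u : 'rV[R]_n).
Hypotheses (gx0 : edom g x0) (x0u : subgradient g x0 u).
Implicit Types (x d : 'rV[R]_n).

Let gE x : edom g x -> g x = (fine (g x))%:E := edomE gNy (x := x).

(** The gap is positive at each point of the sphere by [subgradient_lt], locally uniform by lower
    semicontinuity, and uniform by compactness. *)
Lemma subgradient_sphere_gap (e : R) : 0 < e ->
  exists2 c : R, 0 < c & forall x, `|x - x0| = e ->
    ((fine (g x0) + dotv u (x - x0) + c)%:E <= g x)%E.
Proof.
move=> e0; pose S := [set x | `|x - x0| = e].
have Scompact : compact S.
  apply: bounded_closed_compact.
    exists (e + `|x0|); split; first exact: num_real.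
    move=> r er x /= xe; rewrite -(subrK x0 x) (le_trans (ler_normD _ _))//.
    by rewrite xe ltW.
  have -> : S = (fun x => `|x - x0|) @^-1` [set e] by [].
  apply: closed_comp; last exact: closed_eq.
  move=> x _.
  exact: (cvg_norm (cvgB (FF := nbhs_filter x) cvg_id (cvg_cst x0))).
have Sgap x : S x -> \forall y \near x & c \near (0 : R)^'+,
    ((fine (g x0) + dotv u (y - x0) + c)%:E < g y)%E.
  move=> Sx.
  have : (g x0 + (dotv u (x - x0))%:E < g x)%E.
    apply: (subgradient_lt gNy gcvx x0u gx0) => xx0; move: Sx e0.
    by rewrite /S /= xx0 subrr normr0 => <-; rewrite ltxx.
  rewrite (gE gx0) -EFinD => gap.
  have [b /= ab bx] : exists2 b : R,
      fine (g x0) + dotv u (x - x0) < b & (b%:E < g x)%E.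
    case: (g x) gap => [r| |//]; rewrite ?lte_fin => gap.
      exists ((fine (g x0) + dotv u (x - x0) + r) / 2).
        by rewrite ltr_pdivlMr// mulr_natr mulr2n ltrD2l.
      by rewrite lte_fin ltr_pdivrMr// mulr_natr mulr2n ltrD2r.
    exists (fine (g x0) + dotv u (x - x0) + 1); last exact: ltry.
    by rewrite ltrDl.
  (* Half of the margin absorbs the variation of [dotv u] near [x], the other half absorbs [c]. *)
  pose dl := (b - (fine (g x0) + dotv u (x - x0))) / 2.
  have dl0 : 0 < dl by rewrite divr_gt0// subr_gt0.
  have [V xV gV] := glsc bx.
  exists (V `&` [set y | `|dotv u x - dotv u y| < dl], [set c : R | c < dl]) => /=.
    split; last exact: nbhs_right_lt.
    apply: filterI => //.
    exact: near_dotv.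
  move=> [y c] /= [[/gV yV xy] cdl]; apply: le_lt_trans yV.
  rewrite lee_fin; move: xy cdl; rewrite ltr_norml /dl !dotvBr; lra.
have Snear : \forall c \near (0 : R)^'+,
    S `<=` [set y | ((fine (g x0) + dotv u (y - x0) + c)%:E < g y)%E].
  exact: ((compact_near_coveringP S).1 Scompact R _ _ _ Sgap).
have [c [cS c0]] := filter_ex (filterI Snear (nbhs_right_gt (0 : R))).
by exists c => // x Sx; exact/ltW/cS.
Qed.

(** Convexity on the segment from [x0] to [x], which meets the sphere of radius [e] at parameter
    [t], turns the gap [c] into [c / t], that is [c / e] times the distance to [x0]. *)
Lemma subgradient_growth (e : R) : 0 < e ->
  exists2 c : R, 0 < c & forall x, e <= `|x - x0| ->
    ((fine (g x0) + dotv u (x - x0) + c * `|x - x0|)%:E <= g x)%E.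
Proof.
move=> e0; have [c c0 gap] := subgradient_sphere_gap e0.
exists (c / e); first exact: divr_gt0.
move=> x ex.
have [gx|] := boolP (g x < +oo)%E; last first.
  by rewrite -leNgt leye_eq => /eqP ->; rewrite leey.
have xx0 : 0 < `|x - x0| := lt_le_trans e0 ex.
pose t := e / `|x - x0|.
have t0 : 0 < t by rewrite divr_gt0.
have t1 : t <= 1 by rewrite ler_pdivrMr// mul1r.
have tx : `|x0 + t *: (x - x0) - x0| = e.
  by rewrite addrAC subrr add0r normrZ gtr0_norm// divfK ?gt_eqF.
have := le_trans (gap _ tx) (strictly_convex_le gNy gcvx gx0 gx (ltW t0) t1).
rewrite [x0 + _]addrC addrK dotvZr (gE gx) !lee_fin /= => h.
have {}h : c / t <= fine (g x) - fine (g x0) - dotv u (x - x0).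
  by rewrite ler_pdivrMr//; lra.
by move: h; rewrite /t invf_div mulrA [c * _ / e]mulrAC; lra.
Qed.

Lemma conjugate_ge d : ((dotv d x0 - fine (g x0))%:E <= conjugate g d)%E.
Proof. by apply: ereal_sup_ubound; exists x0 => //; rewrite (gE gx0). Qed.

Lemma conjugate_le d (a : R) :
  (forall x, edom g x -> dotv d x - fine (g x) <= a) -> (conjugate g d <= a%:E)%E.
Proof.
move=> da; apply: ge_ereal_sup => _ [x _ <-].
have [gx|] := boolP (g x < +oo)%E; last first.
  by rewrite -leNgt leye_eq => /eqP ->; rewrite addeNy leNye.
by rewrite (gE gx) -EFinB lee_fin; exact: da.
Qed.

(** Outside the ball of radius [r] the linear growth absorbs [dotv d (x - x0)] for small [d]; inside
    it this term is at most [n * r] times the norm of [d]. *)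
Lemma conjugate_near_le (e : R) : 0 < e -> \forall d \near (0 : 'rV[R]_n),
  (conjugate g (d + u) <= (dotv (d + u) x0 - fine (g x0) + e * `|d|)%:E)%E.
Proof.
move=> e0.
have n0 : 0 < n.+1%:R :> R by [].
have n1 : n%:R <= n.+1%:R :> R by rewrite ler_nat.
(* Chosen so that [n * r <= e]; [n.+1] keeps the quotient meaningful when [n = 0]. *)
pose r := e / n.+1%:R; have r0 : 0 < r by rewrite divr_gt0.
have [c c0 gap] := subgradient_growth r0.
have dcn : 0 < n.+1%:R^-1 * c by rewrite mulr_gt0// invr_gt0.
apply: filterS (nbhs0_le dcn) => d dc'.
have {dc'}dc : n%:R * `|d| <= c.
  rewrite (@le_trans _ _ (n.+1%:R * `|d|))// ?ler_wpM2r//.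
  by rewrite -ler_pdivlMl.
apply: conjugate_le => x gx.
have := le_trans (ler_norm _) (ler_norm_dotv d (x - x0)).
rewrite !dotvDl; have [xr|xr] := leP r `|x - x0|.
  have := gap _ xr; rewrite (gE gx) lee_fin => h1 h2.
  have h3 : n%:R * `|d| * `|x - x0| <= c * `|x - x0| by rewrite ler_wpM2r.
  have h4 : 0 <= e * `|d| by rewrite mulr_ge0// ltW.
  by move: h1 h2 h3; rewrite !dotvBr; lra.
have h1 := subgradient_fine gNy x0u gx0 gx.
have h3 : n%:R * `|d| * `|x - x0| <= e * `|d|.
  rewrite mulrAC ler_wpM2r//.
  rewrite (@le_trans _ _ (n.+1%:R * r))//; last by rewrite /r mulrC divfK.
  by rewrite ler_pM// ltW.
by move: h1 h3; rewrite !dotvBr; lra.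
Unshelve. all: by end_near. Qed.

Lemma conjugate_subgradient : conjugate g u = (dotv u x0 - fine (g x0))%:E.
Proof.
apply/eqP; rewrite eq_le conjugate_ge andbT; apply: conjugate_le => x gx.
by have := subgradient_fine gNy x0u gx0 gx; rewrite dotvBr; lra.
Qed.

Lemma conjugate_near_fin_num : \forall d \near u, conjugate g d \is a fin_num.
Proof.
rewrite (near_shift (0 : 'rV[R]_n)) subr0.
apply: filterS (conjugate_near_le ltr01) => d /= dle.
by rewrite fin_numE -ltNye -ltey (lt_le_trans (ltNyr _) (conjugate_ge _))
  (le_lt_trans dle (ltry _)).
Qed.

(** The conjugate is squeezed between the affine minorant given by [x0] and the bound of
    [conjugate_near_le]; the two agree up to [e] times the norm of [d]. *)
Lemma conjugate_expansion (e : R) : 0 < e -> \forall d \near (0 : 'rV[R]_n),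
  `|fine (conjugate g (d + u)) - fine (conjugate g u) - dotv x0 d| <= e * `|d|.
Proof.
move=> e0; apply: filterS (conjugate_near_le e0) => d /= dle.
have := conjugate_ge (d + u); move: dle; rewrite conjugate_subgradient.
case: (conjugate g (d + u)) => //= r; rewrite !lee_fin ler_norml !dotvDl.
rewrite [dotv x0 d]dotvC; have : 0 <= e * `|d| by rewrite mulr_ge0// ltW.
lra.
Qed.

Lemma conjugate_edifferentiable : edifferentiable (conjugate g) u.
Proof.
split; first exact: conjugate_near_fin_num.
by have [] := @differentiable_dotv _ _ (fine \o conjugate g) _ _ conjugate_expansion.
Qed.

Lemma grad_conjugate : grad (conjugate g) u = x0.
Proof.
have [_ dE] :=
  @differentiable_dotv _ _ (fine \o conjugate g) _ _ conjugate_expansion.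
by apply/rowP => i; rewrite mxE dE dotv_delta.
Qed.

End ConjugateDifferentiability.

(** * Existence of a subgradient at a domain point that may lie on the boundary *)

Section BoundarySubgradient.
Context {R : realType} {n : nat} {g : 'rV[R]_n -> \bar R}.
Hypotheses (gNy : forall x, (-oo < g x)%E) (gcvx : strictly_convex g).
Hypothesis gdiff : forall x, (edom g)° x -> edifferentiable g x.
Variables (z x0 : 'rV[R]_n) (p : R).
Hypotheses (gz : edom g z) (gx0 : (edom g)° x0).
(** Excludes a one-sided derivative [-oo] at [z] towards [x0], with which [z] could have no
    subgradient. *)
Hypothesis slope : forall s, 0 < s -> s <= 1 ->
  fine (g z) + s * p <= fine (g (z + s *: (x0 - z))).
Implicit Types (v w : 'rV[R]_n) (s : R).

Let K := `|fine (g x0) - fine (g z) - p|.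

Let zs s := z + s *: (x0 - z).

(** The gradient inequality is tested at [w] moved by [s] towards [x0]: the difference with [zs s]
    is then [(1 - s) *: (w - z)]. Convexity and [slope] leave an error [s * K], and [s <= 2^-1]
    makes it at most [2 * s * K] after division by [1 - s]. *)
Lemma segment_grad_le s w : 0 < s -> s <= 2^-1 -> edom g w ->
  dotv (grad g (zs s)) (w - z) <= fine (g w) - fine (g z) + 2 * s * K.
Proof.
move=> s0 s12 gw.
have s1 : s <= 1 by lra.
have gx0' := interior_subset gx0.
have zsD : (edom g)° (zs s).
  by apply: (interior_segment gNy gcvx) => //; exact: subset_closure.
have zsu := grad_subgradient gNy gcvx (gdiff zsD).
have gws : edom g (w + s *: (x0 - w)).
  by apply: (edom_segment gNy gcvx) => //; exact: ltW.
have := subgradient_fine gNy zsu (interior_subset zsD) gws.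
have -> : w + s *: (x0 - w) - zs s = (1 - s) *: (w - z).
  by apply/rowP => i; rewrite !mxE; ring.
rewrite dotvZr => h1.
have := strictly_convex_le gNy gcvx gw gx0' (ltW s0) s1.
rewrite (edomE gNy gws) lee_fin => h2.
have h3 := slope s0 s1.
have Kge : fine (g x0) - fine (g z) - p <= K := ler_norm _.
have K0 : 0 <= K by exact: normr_ge0.
have h4 : s * (fine (g x0) - fine (g z) - p) <= s * K by rewrite ler_pM2l.
rewrite -(ler_pM2l (_ : 0 < 1 - s)); last lra.
have h5 : s * K <= (1 - s) * (2 * s * K).
  rewrite mulrA mulrA ler_wpM2r// -[leLHS]mul1r; nra.
rewrite mulrDr; rewrite /zs in h1 h3 h2 *; lra.
Qed.

Lemma segment_grad_ge s : 0 < s -> s <= 1 ->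
  p <= dotv (grad g (zs s)) (x0 - z).
Proof.
move=> s0 s1.
have zsD : (edom g)° (zs s).
  by apply: (interior_segment gNy gcvx) => //; exact: subset_closure.
have zsu := grad_subgradient gNy gcvx (gdiff zsD).
have := subgradient_fine gNy zsu (interior_subset zsD) gz.
have -> : z - zs s = (- s) *: (x0 - z) by apply/rowP => i; rewrite !mxE; ring.
rewrite dotvZr => h; rewrite -(ler_pM2l s0).
have := slope s0 s1; rewrite /zs in h *; lra.
Qed.

(** Upper bounds in the directions from [z] to [x0 + q i] and [x0 - q i], minus the lower bound [p]
    in direction [x0 - z], bound each coordinate from both sides. *)
Lemma segment_grad_bounded : exists M : R, forall s, 0 < s -> s <= 2^-1 ->
  `|grad g (zs s)| <= M.
Proof.
have [r /= r0 gr] := (nbhs_normP x0 (edom g)).1 gx0.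
pose q i : 'rV[R]_n := (r / 2) *: delta_mx ord0 i.
have gq i (e : R) : `|e| <= 1 -> edom g (x0 + e *: q i).
  move=> e1; apply: gr => /=.
  rewrite opprD addrA subrr sub0r normrN /q 2!normrZ (gtr0_norm (_ : 0 < r / 2)) ?divr_gt0//.
  have d1 : `|delta_mx ord0 i : 'rV[R]_n| <= 1.
    rewrite [leLHS]/Num.norm /= mx_normrE; apply/bigmax_leP; split => // -[k j] _ /=.
    by rewrite mxE; case: (_ && _); rewrite ?normr1 ?normr0.
  have : `|e| * (r / 2 * `|delta_mx ord0 i : 'rV[R]_n|) <= 1 * (r / 2 * 1).
    by rewrite ler_pM// ?mulr_ge0// ?ler_wpM2l//; lra.
  lra.
(* The term [K] dominates the error [2 * s * K]; absolute values let the single sum [B] bound every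
   [b i 1] and [b i (-1)]. *)
pose b i (e : R) := `|fine (g (x0 + e *: q i)) - fine (g z) + K - p|.
pose B := \sum_(i < n) (b i 1 + b i (-1)).
have B0 : 0 <= B by apply: sumr_ge0 => i _; rewrite addr_ge0// normr_ge0.
exists (B / (r / 2)) => s s0 s12.
have bound i (e : R) : `|e| <= 1 -> b i e <= B ->
    e * (r / 2 * grad g (zs s) ord0 i) <= B.
  move=> e1 bB.
  have := segment_grad_le s0 s12 (gq i e e1).
  have -> : x0 + e *: q i - z = (x0 - z) + e *: q i by rewrite addrAC.
  rewrite dotvDr /q !dotvZr dotv_delta.
  have : p <= dotv (grad g (zs s)) (x0 - z).
    by apply: segment_grad_ge => //; lra.
  have : 2 * s * K <= K by rewrite ler_piMl// ?normr_ge0//; lra.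
  have := ler_norm (fine (g (x0 + e *: q i)) - fine (g z) + K - p).
  move: bB; rewrite /b /q; lra.
rewrite [leLHS]/Num.norm /= mx_normrE; apply/bigmax_leP; split => [|[k i] _ /=].
  by rewrite divr_ge0// ltW// divr_gt0.
have le_b (e : R) : e = 1 \/ e = -1 -> b i e <= B.
  move=> ee; rewrite /B (bigD1 i)//=.
  have : 0 <= \sum_(j < n | j != i) (b j 1 + b j (-1)).
    by apply: sumr_ge0 => j _; rewrite addr_ge0// normr_ge0.
  have : 0 <= b i 1 by exact: normr_ge0.
  have : 0 <= b i (-1) by exact: normr_ge0.
  by case: ee => ->; lra.
rewrite (ord1 k) ler_pdivlMr ?divr_gt0// mulrC.
rewrite -[X in X * _](gtr0_norm (_ : 0 < r / 2)) ?divr_gt0// -normrM ler_norml.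
have := bound i 1 _ (le_b 1 (or_introl erefl)).
have := bound i (-1) _ (le_b (-1) (or_intror erefl)).
rewrite normrN normr1 => /(_ (lexx _)) h1 /(_ (lexx _)) h2.
by apply/andP; split; lra.
Qed.

(** By contradiction: each [v] in a closed ball containing the gradients is refuted by some [w], and
    the refutation survives small changes of [v] and small [s]. Compactness yields one [s] valid on
    the whole ball, so [grad g (zs s)] violates [segment_grad_le]. *)
Lemma segment_subgradient : exists u, subgradient g z u.
Proof.
have [M gM] := segment_grad_bounded.
pose S := [set v : 'rV[R]_n | `|v| <= M].
have Scompact : compact S.
  apply: bounded_closed_compact.
    exists M; split; first exact: num_real.
    by move=> r Mr v /= /le_trans; apply; exact: ltW.
  have -> : S = (fun v => `|v|) @^-1` [set r | r <= M] by [].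
  apply: closed_comp; last exact: closed_le.
  by move=> v _; exact: norm_continuous.
apply: contrapT => nosub.
have Snear : \forall s \near (0 : R)^'+, S `<=`
    [set v | exists2 w, edom g w & fine (g w) - fine (g z) + 2 * s * K < dotv v (w - z)].
  apply: ((compact_near_coveringP S).1 Scompact R _ _ _ _) => v Sv.
  have [w gw vw] : exists2 w, edom g w & fine (g w) - fine (g z) < dotv v (w - z).
    apply: contrapT => now; apply: nosub; exists v => w.
    have [gw|] := boolP (g w < +oo)%E; last first.
      by rewrite -leNgt leye_eq => /eqP ->; rewrite leey.
    rewrite (edomE gNy gz) (edomE gNy gw) -EFinD lee_fin -lerBrDl leNgt.
    by apply/negP => vw; apply: now; exists w.
  pose dl := (dotv v (w - z) - (fine (g w) - fine (g z))) / 2.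
  have dl0 : 0 < dl by rewrite divr_gt0// subr_gt0.
  have K0 : 0 <= K by exact: normr_ge0.
  (* Below this threshold [2 * s * K < dl]; [K + 1] is positive even if [K = 0]. *)
  have dlK : 0 < dl / (2 * (K + 1)) by rewrite divr_gt0// mulr_gt0//; lra.
  exists ([set v' | `|dotv (w - z) v - dotv (w - z) v'| < dl],
          [set s : R | s < dl / (2 * (K + 1)) /\ 0 < s]) => /=.
    split; first exact: near_dotv.
    by apply: filterI; [exact: nbhs_right_lt|exact: nbhs_right_gt].
  move=> [v' s] /= [vv' [sdl s0]]; exists w => //.
  have : 2 * s * K < dl.
    move: sdl; rewrite ltr_pdivlMr; last lra.
    by nra.
  move: vv'; rewrite ltr_norml ![dotv (w - z) _]dotvC /dl; lra.
have h2 : 0 < 2^-1 :> R by rewrite invr_gt0.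
have [s [[sS s0] s12]] := filter_ex (filterI (filterI Snear
  (nbhs_right_gt (0 : R))) (nbhs_right_ltW h2)).
have [w gw] := sS _ (gM s s0 s12).
by have := segment_grad_le s0 s12 gw; lra.
Qed.

End BoundarySubgradient.

(** * The regularizer [F + I_X] and the mirror descent step *)

Lemma convex_set_segment (R : realType) (n : nat) (X : set 'rV[R]_n) x y (t : R) :
  convex_set X -> X x -> X y -> 0 <= t -> t <= 1 -> X (x + t *: (y - x)).
Proof.
move=> cX Xx Xy t0 t1.
have t01 : Itv.spec (@Itv.num_sem R) (Itv.Real `[0%Z, 1%Z]) t.
  by rewrite /= /Itv.num_sem num_real in_itv /= t0 t1.
have := cX y x (Itv.mk t01) (mem_set Xy) (mem_set Xx).
rewrite inE; congr X.
by apply/rowP => i; rewrite /conv/= !mxE /unstable.onem; ring.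
Qed.

Section MirrorDescent.
Context {R : realType} {n : nat} {X : set 'rV[R]_n} {F : 'rV[R]_n -> \bar R}.
Hypotheses (Xclosed : closed X) (Xconvex : convex_set X) (FX : mirror_map X F).
Implicit Types (x y z u v : 'rV[R]_n).

Let h x := (F x + indicator_fun X x)%E.
Let FNy := mirror_map_gtNy FX.
Let Fcvx := mirror_map_strictly_convex FX.

Lemma add_indicator_in x : X x -> h x = F x.
Proof. by move=> Xx; rewrite /h /indicator_fun mem_set// adde0. Qed.

Lemma add_indicator_out x : ~ X x -> h x = +oo%E.
Proof.
by move=> Xx; rewrite /h /indicator_fun memNset// addey// -ltNye.
Qed.

Lemma le_add_indicator x : (F x <= h x)%E.
Proof.
have [Xx|Xx] := pselect (X x); first by rewrite add_indicator_in.
by rewrite (add_indicator_out Xx) leey.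
Qed.

Lemma edom_add_indicator : edom h = X `&` edom F.
Proof.
apply/seteqP; split => x; last by move=> [Xx]; rewrite /edom/= add_indicator_in.
have [Xx|Xx] := pselect (X x); first by rewrite /edom/= add_indicator_in.
by rewrite /edom/= add_indicator_out.
Qed.

Lemma add_indicator_gtNy x : (-oo < h x)%E.
Proof. exact: lt_le_trans (FNy x) (le_add_indicator x). Qed.

Lemma add_indicator_strictly_convex : strictly_convex h.
Proof.
move=> x y t; rewrite edom_add_indicator => -[Xx Fx] [Xy Fy] xy t0 t1.
rewrite !add_indicator_in//; first exact: Fcvx.
have -> : t *: x + (1 - t) *: y = y + t *: (x - y).
  by apply/rowP => i; rewrite !mxE; ring.
by apply: convex_set_segment => //; exact: ltW.
Qed.

Lemma add_indicator_lsc : lower_semicontinuous h.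
Proof.
move=> x a; have [Xx|Xx] := pselect (X x).
  rewrite add_indicator_in// => /(mirror_map_lsc FX)[V xV FV].
  by exists V => // y /FV /lt_le_trans; apply; exact: le_add_indicator.
move=> _; exists (~` X); last by move=> y Xy; rewrite add_indicator_out// ltry.
by apply: open_nbhs_nbhs; split => //; exact: closed_openC.
Qed.

(** A point of [X] is approached along the segment to a point of [X] interior to the domain:
    convexity keeps it in [X], [interior_segment] puts it in the domain of [F]. *)
Lemma closure_edom_add_indicator : closure (edom h) = X.
Proof.
rewrite edom_add_indicator; apply/seteqP; split => [x|x Xx].
  move=> /(closureS (@subIsetl _ X (edom F))).
  by rewrite -((closure_id X).1 Xclosed).
have [y [Xy Fy]] := mirror_map_meet FX.
move=> V /(nbhs_normP x V)[e /= e0 eV].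
have xF := mirror_map_sub_closure FX Xx.
pose t := Num.min 1 (e / (2 * (`|x - y| + 1))).
have xy0 : 0 < 2 * (`|x - y| + 1) by rewrite mulr_gt0// ltr_wpDl.
have t0 : 0 < t by rewrite lt_min ltr01 divr_gt0.
have t1 : t <= 1 by rewrite ge_min lexx.
have te : t * (2 * (`|x - y| + 1)) <= e.
  by rewrite -ler_pdivlMr// ge_min lexx orbT.
exists (x + t *: (y - x)); split; first split.
- by apply: convex_set_segment => //; exact: ltW.
- apply: interior_subset; apply: (interior_segment FNy Fcvx) => //.
  exact: closureS (@interior_subset _ _) _ xF.
- apply: eV => /=.
  have -> : x - (x + t *: (y - x)) = t *: (x - y).
    by apply/rowP => i; rewrite !mxE; ring.
  rewrite normrZ gtr0_norm//.
  have : 0 <= t * `|x - y| by rewrite mulr_ge0// ltW.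
  lra.
Qed.

Lemma mirror_map_subgradient x : (edom F)° x -> subgradient F x (grad F x).
Proof.
by move=> Fx; exact: grad_subgradient FNy Fcvx _ (mirror_map_differentiable FX Fx).
Qed.

Lemma mirror_map_grad_ex u : exists2 y, (edom F)° y & grad F y = u.
Proof.
have : [set: 'rV[R]_n] u by [].
by rewrite -(mirror_map_grad_surj FX) => -[y Fy yu]; exists y.
Qed.

(** Every [u] is a gradient of [F] at some [y], so [F], and hence [h], lies above an affine function
    of slope [u]. *)
Lemma edom_conjugate_add_indicator : edom (conjugate h) = [set: 'rV[R]_n].
Proof.
apply/seteqP; split => // u _.
have [y Fy <-] := mirror_map_grad_ex u.
apply: le_lt_trans (ltry (dotv (grad F y) y - fine (F y))).
apply: (conjugate_le add_indicator_gtNy) => x.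
rewrite edom_add_indicator => -[Xx Fx]; rewrite add_indicator_in//.
have := subgradient_fine FNy (mirror_map_subgradient Fy) (interior_subset Fy) Fx.
by rewrite dotvBr; lra.
Qed.

Lemma add_indicator_regularizer : regularizer X h.
Proof.
split.
- exact: add_indicator_gtNy.
- exact: add_indicator_strictly_convex.
- exact: add_indicator_lsc.
- exact: closure_edom_add_indicator.
- exact: edom_conjugate_add_indicator.
Qed.

Lemma add_indicator_subgradient x : (X `&` (edom F)°) x ->
  subgradient h x (grad F x).
Proof.
move=> [Xx Fx] y; rewrite add_indicator_in//.
exact: le_trans (mirror_map_subgradient Fx y) (le_add_indicator y).
Qed.

Lemma conjugate_add_indicator x : (X `&` (edom F)°) x ->
  edifferentiable (conjugate h) (grad F x) /\ grad (conjugate h) (grad F x) = x.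
Proof.
move=> XFx; have hx : edom h x.
  by rewrite edom_add_indicator; case: XFx => Xx /interior_subset.
have xu := add_indicator_subgradient XFx.
split.
  exact: (conjugate_edifferentiable add_indicator_gtNy
    add_indicator_strictly_convex add_indicator_lsc hx xu).
exact: (grad_conjugate add_indicator_gtNy
  add_indicator_strictly_convex add_indicator_lsc hx xu).
Qed.

Lemma grad_conjugate_mirror_map y : (edom F)° y ->
  grad (conjugate F) (grad F y) = y.
Proof.
move=> Fy; apply: (grad_conjugate FNy Fcvx (mirror_map_lsc FX)).
  exact: interior_subset.
exact: mirror_map_subgradient.
Qed.

(** Up to a constant, the Bregman divergence from [y] is [F - dotv (grad F y)], so minimality over
    [X] is the subgradient inequality for [h]. *)
Lemma bregman_argmin_subgradient y z : (edom F)° y ->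
  is_argmin X (fun x => bregman F x y) z ->
  X z /\ subgradient h z (grad F y).
Proof.
move=> /interior_subset Fy [Xz zmin]; split => // x.
have [Xx|Xx] := pselect (X x); last by rewrite (add_indicator_out Xx) leey.
rewrite !add_indicator_in//; have := zmin x Xx.
rewrite /bregman (edomE FNy Fy) !dotvBr.
case: (F x) (FNy x) => [b _|_ _|//]; last by rewrite leey.
by case: (F z) (FNy z) => [a _|//|//]; rewrite /= !lee_fin; lra.
Qed.

(** Here [u] need not be a subgradient of [F]; it is only used inside [X], on the segment to [x0],
    to supply [slope] with [p = dotv u (x0 - z)]. *)
Lemma subgradient_interior z u : X z -> subgradient h z u -> (edom F)° z.
Proof.
move=> Xz zu.
have [x0 [Xx0 Fx0]] := mirror_map_meet FX.
(* If [F z] were infinite, the subgradient inequality at [x0] would make [F x0] infinite. *)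
have Fz : edom F z.
  rewrite /edom/= -(add_indicator_in Xz) ltNge leye_eq; apply/negP => /eqP hz.
  have := zu x0; rewrite hz addye// add_indicator_in// leye_eq => /eqP Fx0y.
  by have := interior_subset Fx0; rewrite /edom/= Fx0y ltxx.
have hz : edom h z by rewrite edom_add_indicator.
have slope s : 0 < s -> s <= 1 ->
    fine (F z) + s * dotv u (x0 - z) <= fine (F (z + s *: (x0 - z))).
  move=> s0 s1; have s0' := ltW s0.
  have Xs := convex_set_segment Xconvex Xz Xx0 s0' s1.
  have hs : edom h (z + s *: (x0 - z)).
    rewrite edom_add_indicator; split => //.
    exact: (edom_segment FNy Fcvx Fz (interior_subset Fx0) s0' s1).
  have := subgradient_fine add_indicator_gtNy zu hz hs.
  by rewrite !add_indicator_in// [z + _ - z]addrC addrA addNr add0r dotvZr.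
have [v zv] := segment_subgradient FNy Fcvx (mirror_map_differentiable FX)
  Fz Fx0 slope.
have [y Fy yv] := mirror_map_grad_ex v.
have yu := mirror_map_subgradient Fy; rewrite yv in yu.
by rewrite (subgradient_inj FNy Fcvx Fz (interior_subset Fy) zv yu).
Qed.

(** On the segment from [z] to [x], which stays in [X], [F] equals [h] and grows at least with slope
    [dotv u (x - z)]; so does its derivative at [z]. *)
Lemma subgradient_variational z u x : X z -> subgradient h z u -> X x ->
  0 <= dotv (grad F z - u) (x - z).
Proof.
move=> Xz zu Xx; have Fz := subgradient_interior Xz zu.
have [zfin dF] := mirror_map_differentiable FX Fz.
rewrite dotvBl subr_ge0 -(derive_grad _ (mirror_map_differentiable FX Fz)).
apply: derive_ge_right => //.
have hz : edom h z by rewrite edom_add_indicator; split => //; exact: interior_subset.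
have zfin' : \forall t \near (0 : R)^'+, F (t *: (x - z) + z) \is a fin_num.
  have zfin0 : \forall d \near (0 : 'rV[R]_n), F (d + z) \is a fin_num.
    by move: zfin; rewrite (near_shift (0 : 'rV[R]_n)) subr0.
  exact: cvg_within (near0Z (x - z) zfin0).
near=> t.
have t0 : 0 < t by near: t; exact: nbhs_right_gt.
have t1 : t <= 1 by near: t; exact: nbhs_right_ltW.
have Xt : X (t *: (x - z) + z).
  by rewrite addrC; apply: convex_set_segment => //; exact: ltW.
have ht : edom h (t *: (x - z) + z).
  rewrite edom_add_indicator; split => //.
  suff : F (t *: (x - z) + z) \is a fin_num by rewrite /edom/= ltey_eq => ->.
  by near: t.
have := subgradient_fine add_indicator_gtNy zu hz ht.
by rewrite !add_indicator_in// addrK dotvZr /=; lra.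
Unshelve. all: by end_near. Qed.

(** Surjectivity of the gradient writes [grad F y + u] as [grad F y'] with [y'] interior, whatever
    [y] is; interiority of the iterates thus requires no induction. *)
Lemma MD_step_UMD u y z :
  is_argmin X (fun x => bregman F x (grad (conjugate F) (grad F y + u))) z ->
  (X `&` (edom F)°) z /\
  forall x, X x -> 0 <= dotv (grad F z - grad F y - u) (x - z).
Proof.
have [y' Fy' y'u] := mirror_map_grad_ex (grad F y + u).
rewrite -y'u grad_conjugate_mirror_map// => /(bregman_argmin_subgradient Fy')[Xz].
rewrite y'u => zu; split => [|x Xx].
  by split => //; exact: subgradient_interior zu.
by rewrite -addrA -opprD; exact: subgradient_variational.
Qed.

Lemma MD_iterates_interior xi (x : nat -> 'rV[R]_n) : MD_iterates X F xi x ->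
  forall t, (1 <= t)%N -> (X `&` (edom F)°) (x t).
Proof.
(* Index 0 is excluded, index 1 is the initial condition, and [t.+2] comes from the step at
   [t.+1]. *)
move=> MDx [//|[|t]] _; first exact: MD_init MDx.
exact: (MD_step_UMD (MD_step MDx (ltn0Sn t))).1.
Qed.

End MirrorDescent.

Unset Implicit Arguments.

Theorem proposition3p5 (R : realType) (n : nat) (X : set 'rV[R]_n)
  (F : 'rV[R]_n -> \bar R) (xi x : nat -> 'rV[R]_n) :
  X !=set0 -> closed X -> convex_set X ->
  mirror_map X F ->
  MD_iterates X F xi x ->
  UMD_iterates X (fun z => F z + indicator_fun X z)%E xi (fun t => (x t, grad F (x t))).
Proof.
move=> _ Xclosed Xconvex FX MDx.
have xD := MD_iterates_interior Xconvex FX MDx.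
split => /= [|t t1|t t1|t t1 y Xy].
- exact: add_indicator_regularizer.
- exact: (conjugate_add_indicator Xclosed Xconvex FX (xD t t1)).1.
- by rewrite (conjugate_add_indicator Xclosed Xconvex FX (xD t t1)).2.
- exact: (MD_step_UMD Xconvex FX (MD_step MDx t1)).2.
Qed.
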